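(* There is a deterministic $2$-round $k$-clustering algorithm that recovers every hidden $k$-clustering of an $n$-point universe exactly using $O(n\log k)$ subset queries.
   Context: Let $U$ be a set of $n$ points with a hidden partition $U=C_1\sqcup\cdots\sqcup C_k$. A subset query on $S\subseteq U$ returns $\mathsf{count}(S)=|\{i\in[k]: C_i\cap S\neq\emptyset\}|$. A $2$-round algorithm specifies a first batch of queries, receives all answers, then (depending on these answers) specifies a second batch of queries, receives all answers, and then outputs the clustering. *)

(* Defs.v *)
From mathcomp Require Import all_boot.

Set Implicit Arguments.
Unset Strict Implicit.
Unset Printing Implicit Defensive.

(* U = C_1 |_| ... |_| C_k; clusters are allowed to be empty, so that
   partitions into fewer than k parts are covered as well. *)
Definition is_clustering (U : finType) (k : nat) (C : 'I_k -> {set U}) : Prop :=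
  (forall i j, i != j -> [disjoint C i & C j]) /\
  \bigcup_(i < k) C i = [set: U].

Definition subset_count (U : finType) (k : nat) (C : 'I_k -> {set U})
    (S : {set U}) : nat :=
  #|[set i | C i :&: S != set0]|.

Definition answers (U : finType) (k : nat) (C : 'I_k -> {set U})
    (qs : seq {set U}) : seq nat :=
  [seq subset_count C Q | Q <- qs].

Record two_round_algorithm (U : finType) := TwoRoundAlgorithm {
  round1 : seq {set U};
  round2 : seq nat -> seq {set U};
  output : seq nat -> seq nat -> {set {set U}}
}.

Definition answers1 (U : finType) (k : nat) (A : two_round_algorithm U)
    (C : 'I_k -> {set U}) : seq nat :=
  answers C (round1 A).

Definition answers2 (U : finType) (k : nat) (A : two_round_algorithm U)
    (C : 'I_k -> {set U}) : seq nat :=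
  answers C (round2 A (answers1 A C)).

Definition result (U : finType) (k : nat) (A : two_round_algorithm U)
    (C : 'I_k -> {set U}) : {set {set U}} :=
  output A (answers1 A C) (answers2 A C).

Definition num_queries (U : finType) (k : nat) (A : two_round_algorithm U)
    (C : 'I_k -> {set U}) : nat :=
  size (round1 A) + size (round2 A (answers1 A C)).

(* Queries are invariant under relabelling the clusters, so what is recovered
   is the unlabelled partition of U into the nonempty clusters. *)
Definition clusters (U : finType) (k : nat) (C : 'I_k -> {set U}) :
    {set {set U}} :=
  [set C i | i : 'I_k] :\ set0.

(* Main.v *)
Require Import Defs.
From mathcomp Require Import all_boot all_order all_algebra reals exp.

(** Fix an enumeration of [U].  Round 1 queries the nonempty prefixes of the
    enumeration: the count jumps exactly at the first point of each cluster, so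
    the answers reveal a set of representatives, one per nonempty cluster.
    Give the (at most [k]) representatives distinct codes of [up_log 2 k] bits.
    Round 2 queries, for every point [x] and bit [b], the set made of [x] and of
    the representatives whose code has bit [b]: the count exceeds the number of
    those representatives by one exactly when the representative of [x] is not
    among them, so the answers reveal the code of the representative of [x]. *)

Set Implicit Arguments.
Unset Strict Implicit.
Unset Printing Implicit Defensive.

Import Order.TTheory GRing.Theory Num.Theory.

Section Labelling.

Variables (U : finType) (k : nat).

(** Covering gives each point a label and disjointness makes it unique. From here on the clustering
    is handled through [f], and counts become cardinals of images under [f]. *)
Lemma clustering_label (C : 'I_k -> {set U}) : is_clustering C ->
  exists f : U -> 'I_k, forall x i, (x \in C i) = (f x == i).
Proof.
case=> disjC coverC.
have /fin_all_exists[f fC] (x : U) : exists i, x \in C i.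
  have /bigcupP[i _ xCi] : x \in \bigcup_(i < k) C i by rewrite coverC inE.
  by exists i.
exists f => x i; apply/idP/eqP => [xCi|<- //]; apply/eqP/negPn/negP => /disjC.
by move=> /disjointFr-/(_ x (fC x)); rewrite xCi.
Qed.

Variables (C : 'I_k -> {set U}) (f : U -> 'I_k).
Hypothesis fE : forall x i, (x \in C i) = (f x == i).

Lemma subset_count_label S : subset_count C S = #|f @: S|.
Proof.
apply: eq_card => i; rewrite inE; apply/set0Pn/imsetP => [[x]|[x xS ->]].
  by rewrite inE fE => /andP[/eqP <- xS]; exists x.
by exists x; rewrite inE fE eqxx.
Qed.

(** Reduces correctness to deciding [f x == f y] from the answers, since the algorithm also outputs
    an [equivalence_partition]. *)
Lemma clusters_label :
  clusters C = equivalence_partition (fun x y => f x == f y) [set: U].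
Proof.
have fibreE x : [set y in [set: U] | f x == f y] = C (f x).
  by apply/setP => y; rewrite !inE fE eq_sym.
apply/setP => B; rewrite in_setD1; apply/andP/imsetP => [[B0 /imsetP[i _ BE]]|].
  have /set0Pn[x] := B0; rewrite BE fE => /eqP fx.
  by exists x => //; rewrite fibreE fx.
move=> [x _ ->]; rewrite fibreE; split; last exact: imset_f.
by apply/set0Pn; exists x; rewrite fE.
Qed.

End Labelling.

Section Algorithm.

Variable U : finType.
Implicit Types (qs : seq {set U}) (ans : seq nat) (R : {set U}).

(* Returns the default value 0 on an unasked query, which is the correct answer
   for the empty set. *)
Definition lookup qs ans (Q : {set U}) : nat := nth 0 ans (index Q qs).

Lemma lookup_answers k (C : 'I_k -> {set U}) qs Q :
  (Q \in qs) || (Q == set0) -> lookup qs (answers C qs) Q = subset_count C Q.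
Proof.
rewrite /lookup; have [Qqs _|Qqs /= /eqP Q0] := boolP (Q \in qs).
  by rewrite (nth_map set0) ?index_mem// nth_index.
rewrite nth_default ?size_map ?memNindex// Q0.
by apply/esym/eq_card0 => i; rewrite !inE setI0 eqxx.
Qed.

Definition prefix_set i : {set U} := [set y | enum_rank y < i].

Definition prefix_queries := [seq prefix_set i | i <- iota 1 #|U|].

Definition representatives ans : {set U} :=
  [set x | lookup prefix_queries ans (prefix_set (enum_rank x).+1)
           != lookup prefix_queries ans (prefix_set (enum_rank x))].

(** A codeword of [L] bits is encoded as the set of positions where the bit is 1. *)
Definition code L R (r : U) : {set 'I_L} :=
  nth set0 (enum {set 'I_L}) (index r (enum R)).

Definition bit_query L R x (b : 'I_L) : {set U} :=
  x |: [set r in R | b \in code L R r].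

Definition bit_queries L R :=
  [seq bit_query R x b | x <- enum U, b <- enum 'I_L].

(* For [k <= 1] the bound [n * ln k] vanishes and no query may be asked. *)
Definition clustering_algorithm k : two_round_algorithm U :=
  let L := up_log 2 k in
  let queries2 ans := bit_queries L (representatives ans) in
  TwoRoundAlgorithm (if k <= 1 then [::] else prefix_queries) queries2
    (fun ans1 ans2 =>
       let answer x b := lookup (queries2 ans1) ans2
                           (@bit_query L (representatives ans1) x b) in
       equivalence_partition
         (fun x y => [forall b, answer x b == answer y b]) [set: U]).

(** There are [2 ^ L] codewords, so every index stays within their duplicate-free enumeration and
    [nth] never falls back on its default. *)
Lemma code_inj L R : #|R| <= 2 ^ L -> {in R &, injective (code L R)}.
Proof.
move=> RL r s rR sR /eqP.
have lt_code t : t \in R -> index t (enum R) < size (enum {set 'I_L}).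
  move=> tR; rewrite -cardE -cardsT -powersetT card_powerset cardsT card_ord.
  rewrite (leq_trans _ RL)// cardE.
  by rewrite index_mem mem_enum.
rewrite nth_uniq ?lt_code ?enum_uniq// => /eqP/index_inj.
by apply; rewrite ?mem_enum.
Qed.

Variables (k : nat) (C : 'I_k -> {set U}) (f : U -> 'I_k).
Hypothesis fE : forall x i, (x \in C i) = (f x == i).

Local Notation reps := (representatives (answers C prefix_queries)).

Lemma subset_countU1 x S :
  subset_count C (x |: S) = (f x \notin f @: S) + #|f @: S|.
Proof. by rewrite (subset_count_label fE) imsetU1 cardsU1. Qed.

(** Consecutive prefixes differ by [x] alone, so their counts differ exactly when the label of [x]
    is new. *)
Lemma mem_representatives x :
  (x \in reps) = (f x \notin f @: prefix_set (enum_rank x)).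
Proof.
(* The empty prefix, needed for the first point, is not queried: the default of [lookup] supplies
   its count. *)
have prefixP i : i <= #|U| ->
    (prefix_set i \in prefix_queries) || (prefix_set i == set0).
  case: i => [_|i lti].
    by apply/orP; right; apply/eqP/setP => y; rewrite !inE.
  by rewrite map_f// mem_iota.
rewrite inE !lookup_answers ?prefixP//; last exact/ltnW.
have -> : prefix_set (enum_rank x).+1 = x |: prefix_set (enum_rank x).
  apply/setP => y; rewrite !inE ltnS leq_eqVlt; congr (_ || _).
  by rewrite (inj_eq val_inj) (inj_eq enum_rank_inj).
rewrite subset_countU1 (subset_count_label fE).
by case: (_ \notin _); rewrite ?add0n ?eqxx// add1n neq_ltn ltnSn orbT.
Qed.

(** Of two distinct points with the same label, the later one finds its label already in the prefix
    before it. *)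
Lemma representatives_inj : {in reps &, injective f}.
Proof.
move=> r s; wlog le_rs : r s / enum_rank r <= enum_rank s.
  move=> W rR sR; have [/W|/ltnW /W W'] := leqP (enum_rank r) (enum_rank s).
    exact.
  by move/esym/W' => ->.
move=> _; rewrite mem_representatives => /imsetP sR fE_rs.
have [lt_rs|] := ltnP (enum_rank r) (enum_rank s).
  by case: sR; exists r; rewrite ?inE.
move=> le_sr; apply: enum_rank_inj; apply/val_inj/eqP.
by rewrite eqn_leq le_rs.
Qed.

(** The witness is the point of least rank in the cluster of [x]. *)
Lemma representatives_surj x : exists2 r, r \in reps & f r = f x.
Proof.
have [r /eqP fr min_r] :=
  @arg_minnP _ x (fun y => f y == f x) (fun y => enum_rank y) (eqxx _).
exists r => //; rewrite mem_representatives; apply/imsetP => -[y].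
rewrite inE fr => ltyr fy.
by have := min_r y; rewrite -fy eqxx leqNgt ltyr => /(_ isT).
Qed.

Lemma card_representatives : #|reps| <= k.
Proof.
rewrite -(card_in_imset representatives_inj).
by rewrite (leq_trans (max_card _)) ?card_ord.
Qed.

(** As [f] is injective on representatives, the label of [x] is already present exactly when [r]
    itself is in the query. The second summand does not depend on [x]. *)
Lemma bit_query_count L r x (b : 'I_L) : r \in reps -> f r = f x ->
  subset_count C (bit_query reps x b)
    = (b \notin code L reps r) + #|f @: [set s in reps | b \in code L reps s]|.
Proof.
move=> rR frx; rewrite subset_countU1; congr (nat_of_bool (~~ _) + _).
apply/imsetP/idP => [[s]|br]; last by exists r => //; rewrite inE rR.
by rewrite inE -frx => /andP[sR bs] /(representatives_inj rR sR) ->.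
Qed.

(** Comparing raw answers suffices, without decoding: the common summand cancels, so equal answers
    mean equal codes, hence equal representatives. *)
Lemma bit_queries_separate L x y : k <= 2 ^ L ->
  [forall b : 'I_L, subset_count C (bit_query reps x b)
                    == subset_count C (bit_query reps y b)] = (f x == f y).
Proof.
move=> kL; have [[r rR frx] [s sR fsy]] :=
  (representatives_surj x, representatives_surj y).
apply/forallP/eqP => [eq_xy|fxy b]; last first.
  by rewrite (bit_query_count b rR frx) (bit_query_count b rR (etrans frx fxy)).
rewrite -frx -fsy; congr f.
apply: (code_inj (leq_trans card_representatives kL)) => //.
apply/setP => b; have := eq_xy b.
rewrite (bit_query_count b rR frx) (bit_query_count b sR fsy) eqn_add2r.
by do 2 case: (_ \in _).
Qed.

Lemma clustering_algorithm_correct :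
  result (clustering_algorithm k) C = clusters C.
Proof.
rewrite (clusters_label fE) /result /=; set R := representatives _.
apply: eq_imset => x; apply/setP => y; rewrite !inE /=.
have lookupE z (b : 'I_(up_log 2 k)) : lookup (bit_queries (up_log 2 k) R)
    (answers2 (clustering_algorithm k) C) (bit_query R z b)
    = subset_count C (bit_query R z b).
  apply: lookup_answers; apply/orP; left.
  by apply/allpairsP; exists (z, b); rewrite !mem_enum.
under eq_forallb do rewrite !lookupE.
have [k1|k1] := leqP k 1; last first.
  by rewrite /R /answers1 /= leqNgt k1; apply/bit_queries_separate/up_logP.
(* For [k <= 1] nothing was asked, but at most one label exists and there are no bits, so both sides
   hold trivially. *)
have -> : f x == f y.
  have f0 z : f z = 0 :> nat.
    by apply/eqP; rewrite -leqn0 -ltnS (leq_trans (ltn_ord _) k1).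
  by apply/eqP/val_inj; rewrite /= !f0.
apply/forallP => -[b bL]; suff: false by [].
by move: bL; have/eqP-> : up_log 2 k == 0 by rewrite up_log_eq0 k1 orbT.
Qed.

Lemma clustering_algorithm_size :
  num_queries (clustering_algorithm k) C
    = if k <= 1 then 0 else #|U| * (up_log 2 k).+1.
Proof.
rewrite /num_queries /= size_allpairs -!cardE card_ord mulnS.
case: leqP => [k1|_]; last by rewrite size_map size_iota.
suff -> : up_log 2 k = 0 by rewrite muln0.
by apply/eqP; rewrite up_log_eq0 k1 orbT.
Qed.

End Algorithm.

Local Open Scope ring_scope.

(** Write [L + 1 = (L - 1) + 2] for [L = up_log 2 k]. Since [2 ^ (L - 1) < k] and [2 <= k], the
    summands are at most [ln k / ln 2] and [2 * ln k / ln 2], whence the constant 3. *)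
Lemma up_log_le_ln (R : realType) k : (1 < k)%N ->
  (up_log 2 k).+1%:R <= 3 / ln 2 * ln k%:R :> R.
Proof.
move=> k1; have ln2_gt0 : 0 < ln 2 :> R by rewrite ln_gt0 ?ltr1n.
have /andP[lt_k _] := up_log_bounds (isT : 1 < 2)%N k1.
have k0 : 0 < k%:R :> R by rewrite ltr0n ltnW.
have ln2k : ln 2 <= ln k%:R :> R by rewrite ler_ln ?posrE// ler_nat.
have logk : (up_log 2 k).-1%:R * ln 2 <= ln k%:R :> R.
  rewrite mulr_natl -lnXn ?ltr0n// ler_ln ?posrE ?exprn_gt0//.
  by rewrite -natrX ler_nat ltnW.
rewrite mulrAC ler_pdivlMr//.
have -> : (up_log 2 k).+1%:R = (up_log 2 k).-1%:R + 2 :> R.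
  by rewrite -natrD addn2 prednK// up_log_gt0.
rewrite mulrDl; have -> : 3 * ln k%:R = ln k%:R + 2 * ln k%:R :> R.
  by rewrite -[X in X + _]mul1r -mulrDl nat1r.
by rewrite lerD// ler_pM2l ?ltr0n.
Qed.

Theorem theorem5p1 (R : realType) :
  exists (A : forall (U : finType) (k : nat), two_round_algorithm U) (c : R),
    forall (U : finType) (k : nat) (C : 'I_k -> {set U}),
      is_clustering C ->
      result (A U k) C = clusters C /\
      (num_queries (A U k) C)%:R <= c * (#|U|%:R * ln k%:R).
Proof.
exists clustering_algorithm, (3 / ln 2) => U k C /clustering_label[f fE].
split; first exact: clustering_algorithm_correct fE.
rewrite clustering_algorithm_size; case: leqP => [|k1]; last first.
  by rewrite natrM mulrCA ler_wpM2l// up_log_le_ln.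
(* Both sides vanish; for [k = 0] this uses the convention [ln 0 = 0]. *)
by case: k {C f fE} => [|[|//]] _; rewrite (ln0 (lexx 0), ln1) !mulr0.
Qed.
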